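(* Let $\mathcal A$ and $\mathcal B$ be two chains of linear mappings with the same number $t$ of spaces and the same orientation of arrows, either both on unitary spaces or both on Euclidean spaces. Then $\mathcal A$ and $\mathcal B$ are topologically isomorphic if and only if they are linearly isomorphic.
   Context: A unitary (respectively, Euclidean) space is a finite-dimensional complex (respectively, real) inner product space, with its usual metric topology. Let $t$ be a positive integer. A chain of linear mappings $\mathcal A$ consists of spaces $U_1,\dots,U_t$ and, for each $i=1,\dots,t-1$, a linear mapping $A_i$ which is either $A_i:U_i\to U_{i+1}$ (the $i$-th arrow points right) or $A_i:U_{i+1}\to U_i$ (the $i$-th arrow points left). The directions of the $t-1$ arrows form the orientation of the chain. Let $\mathcal A$ (spaces $U_1,\dots,U_t$, mappings $A_1,\dots,A_{t-1}$) and $\mathcal B$ (spaces $V_1,\dots,V_t$, mappings $B_1,\dots,B_{t-1}$) be chains with the same orientation. Write $\varphi:\mathcal A\xrightarrow{\sim}\mathcal B$ if $\varphi=\{\varphi_i:U_i\to V_i\}_{i=1}^t$ is a system of bijections such that for each $i=1,\dots,t-1$: $\varphi_{i+1}A_i=B_i\varphi_i$ if $A_i:U_i\to U_{i+1}$, and $\varphi_iA_i=B_i\varphi_{i+1}$ if $A_i:U_{i+1}\to U_i$. Such a $\varphi$ is a linear isomorphism if every $\varphi_i$ is a linear bijection, and a topological isomorphism if every $\varphi_i$ is a homeomorphism (i.e. $\varphi_i$ and $\varphi_i^{-1}$ are continuous; linearity is not required). The chains $\mathcal A$ and $\mathcal B$ are linearly (respectively, topologically) isomorphic if there exists a linear (respectively,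 topological) isomorphism $\varphi:\mathcal A\xrightarrow{\sim}\mathcal B$. *)

(* Defs.v *)
From HB Require Import structures.
From mathcomp Require Import all_boot all_order all_algebra sesquilinear complex.
From mathcomp Require Import all_classical all_reals all_analysis.

Set Implicit Arguments.
Unset Strict Implicit.
Unset Printing Implicit Defensive.

Import Order.TTheory GRing.Theory Num.Theory.
Import numFieldNormedType.Exports.

Local Open Scope ring_scope.

#[short(type="normedVectType")]
HB.structure Definition NormedVector (K : numFieldType) :=
  { V of NormedModule K V & Vector K V }.

(* [inner_normE] makes the norm, hence the topology, of [inner_sort] the one
   given by the inner product. For K = R[i] norms are K-valued; they are
   nonnegative for the partial order of R[i], hence real. *)
Record innerSpace (K : numFieldType) (theta : K -> K) := InnerSpace {
  inner_sort :> normedVectType K;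
  inner : {dot inner_sort for theta};
  inner_normE : forall x : inner_sort, `|x| ^+ 2 = inner x x
}.

Definition euclideanSpace (R : realType) : Type :=
  innerSpace (idfun : R -> R).

Definition unitarySpace (R : realType) : Type :=
  innerSpace (Num.conj : R[i] -> R[i]).

(* The t spaces are indexed by 'I_t and the t - 1 arrows by 'I_t.-1, both from
   0: arrow i joins spaces i and i.+1. An orientation is a map
   o : 'I_t.-1 -> bool, where [o i] means that arrow i points right. *)
Lemma left_end_subproof (t : nat) (i : 'I_t.-1) : (i < t)%N.
Proof. exact: leq_trans (ltn_ord i) (leq_pred t). Qed.

Lemma right_end_subproof (t : nat) (i : 'I_t.-1) : (i.+1 < t)%N.
Proof. by rewrite -ltn_predRL. Qed.

Definition left_end (t : nat) (i : 'I_t.-1) : 'I_t :=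
  Ordinal (left_end_subproof i).

Definition right_end (t : nat) (i : 'I_t.-1) : 'I_t :=
  Ordinal (right_end_subproof i).

Definition arrow_source (t : nat) (o : 'I_t.-1 -> bool) (i : 'I_t.-1) : 'I_t :=
  if o i then left_end i else right_end i.

Definition arrow_target (t : nat) (o : 'I_t.-1 -> bool) (i : 'I_t.-1) : 'I_t :=
  if o i then right_end i else left_end i.

Record chain (K : numFieldType) (theta : K -> K) (t : nat)
    (o : 'I_t.-1 -> bool) := Chain {
  chain_space : 'I_t -> innerSpace theta;
  chain_map : forall i : 'I_t.-1,
    {linear chain_space (arrow_source o i) -> chain_space (arrow_target o i)}
}.

Definition euclideanChain (R : realType) (t : nat) (o : 'I_t.-1 -> bool) :
  Type := chain (idfun : R -> R) o.

Definition unitaryChain (R : realType) (t : nat) (o : 'I_t.-1 -> bool) :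
  Type := chain (Num.conj : R[i] -> R[i]) o.

Definition homeomorphism (X Y : topologicalType) (f : X -> Y) : Prop :=
  exists g : Y -> X,
    [/\ cancel f g, cancel g f, continuous f & continuous g].

Section ChainIsomorphism.
Variables (K : numFieldType) (theta : K -> K) (t : nat) (o : 'I_t.-1 -> bool).
Variables A B : chain theta o.

Definition chain_iso
    (phi : forall i : 'I_t, chain_space A i -> chain_space B i) : Prop :=
  (forall i : 'I_t, bijective (phi i)) /\
  (forall (i : 'I_t.-1) (x : chain_space A (arrow_source o i)),
     phi (arrow_target o i) (chain_map A i x) =
     chain_map B i (phi (arrow_source o i) x)).

Definition linearly_isomorphic : Prop :=
  exists phi : forall i : 'I_t, chain_space A i -> chain_space B i,
    chain_iso phi /\ forall i : 'I_t, linear (phi i).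

Definition topologically_isomorphic : Prop :=
  exists phi : forall i : 'I_t, chain_space A i -> chain_space B i,
    chain_iso phi /\ forall i : 'I_t, homeomorphism (phi i).

End ChainIsomorphism.

(* Main.v *)
Require Import Defs.
From HB Require Import structures.
From mathcomp Require Import all_boot all_order all_algebra.
From mathcomp Require Import fingroup perm sesquilinear complex.
From mathcomp Require Import all_classical all_reals all_analysis.
From mathcomp Require Import ring lra zify.

(* A topological isomorphism, translated so as to fix the origins, matches the
   subspaces obtained from one another by images and preimages under the maps
   of the chains, and it preserves their dimensions by invariance of
   dimension. Sweeping along the chain, these subspaces form a flag in each
   space: a right arrow sends the flag to the images of its members followed by
   the whole space, a left arrow to the kernel followed by the preimages. By
   induction on the length, every linear isomorphism between the last spaces
   that respects the flags extends to a linear isomorphism of the chains, since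
   equal dimensions allow it to be lifted through an arrow one flag member at a
   time.

   Invariance of dimension: let f : R^n -> R^m be continuous with continuous
   left inverse and m < n. The functions h_i(x) = inf_y (y_i + L|f x - f y|) on
   the unit cube are Lipschitz with respect to |f x - f y| and, for large L,
   close to x_i. By a cubical Sperner lemma (h_i) comes close to every point of
   a subcube; p^n points at mutual distance ~1/p then give p^n points of f(cube)
   at mutual distance ~1/p, but a bounded set of R^m contains only O(p^m) such
   points.

   The Sperner lemma is the statement that the cup product df_1 ... df_n of
   {0,1}-valued functions on the grid, evaluated mod 2 on the Freudenthal
   triangulation, depends only on the boundary values of the f_i. *)

Set Implicit Arguments.
Unset Strict Implicit.
Unset Printing Implicit Defensive.

Import Order.TTheory GRing.Theory Num.Theory.
Import numFieldNormedType.Exports.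

Local Open Scope classical_set_scope.
Local Open Scope ring_scope.

(** * A cubical Sperner lemma *)

Lemma addrr_F2 (x : 'F_2) : x + x = 0.
Proof. by rewrite -mulr2n mulrn_pchar // pchar_Fp. Qed.

(** Over ['F_2] the alternating signs disappear. A simplex is a sequence of vertices of which only
    an initial segment matters, so its [j]-th face is the precomposition with [bump j]. *)
Definition coboundary (T : Type) (m : nat) (phi : (nat -> T) -> 'F_2)
  (w : nat -> T) : 'F_2 := \sum_(j < m.+2) phi (w \o bump j).

(* The cup product of the coboundaries of the [f i], evaluated on the ordered
   simplex [w]. *)
Definition cup_path (T : Type) (n : nat) (f : nat -> T -> 'F_2)
  (w : nat -> T) : 'F_2 := \prod_(i < n) (f i (w i) + f i (w i.+1)).

(* As [cup_path], with [f k] in place of its coboundary; hence a simplex with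
   one vertex fewer, and a primitive of [cup_path]. *)
Definition cup_hole (T : Type) (k n : nat) (f : nat -> T -> 'F_2)
    (w : nat -> T) : 'F_2 :=
  f k (w k) * \prod_(i < n | i != k :> nat)
    (f i (w (unbump k i)) + f i (w (unbump k i).+1)).

(** Leibniz rule for a closed first factor: faces 0 and 1 share the value of [phi], and their
    coefficients add up to [f (w 0) + f (w 1)] because [f (w 2)] occurs twice. *)
Lemma coboundary_cup (T : Type) m (f : T -> 'F_2) (phi : (nat -> T) -> 'F_2) w :
  coboundary m.+1 (fun v => (f (v 0) + f (v 1)) * phi (v \o S)) w =
  (f (w 0) + f (w 1)) * coboundary m phi (w \o S).
Proof.
have face0 : (w \o bump 1) \o S = (w \o S) \o bump 0 by [].
have faceS i : (w \o bump i.+2) \o S = (w \o S) \o bump i.+1.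
  by apply: funext => j; rewrite /= /bump ltnS addnS.
have bump0 i : bump 0 i = i.+1 by [].
rewrite /coboundary 2!big_ord_recl [in RHS]big_ord_recl /= !bump0.
under eq_bigr => i _ do
  rewrite !bump0 faceS (_ : bump i.+2 0 = 0) // (_ : bump i.+2 1 = 1) //.
under [in RHS]eq_bigr => i _ do rewrite bump0.
rewrite -big_distrr /= face0 (_ : (w \o bump 0) \o S = (w \o S) \o bump 0) //.
rewrite (_ : bump 1 0 = 0) // (_ : bump 1 1 = 2) //.
set X := phi _; set Y := \sum_(i < _) _.
have := addrr_F2 (f (w 2)); move: (f _) (f _) (f _) => a b c cc.
transitivity ((a + b) * (X + Y) + (c + c) * X); first by ring.
by rewrite cc mul0r addr0.
Qed.

Lemma cup_path_recl (T : Type) n (f : nat -> T -> 'F_2) w :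
  cup_path n.+1 f w =
  (f 0 (w 0) + f 0 (w 1)) * cup_path n (f \o S) (w \o S).
Proof. by rewrite /cup_path big_ord_recl. Qed.

Lemma cup_hole0 (T : Type) n (f : nat -> T -> 'F_2) w :
  cup_hole 0 n.+1 f w = f 0 (w 0) * cup_path n (f \o S) w.
Proof.
rewrite /cup_hole big_mkcond big_ord_recl /= mul1r; congr (_ * _).
by apply: eq_bigr => i _; rewrite /= /unbump /= !subn1.
Qed.

Lemma cup_holeS (T : Type) k n (f : nat -> T -> 'F_2) w :
  cup_hole k.+1 n.+1 f w =
  (f 0 (w 0) + f 0 (w 1)) * cup_hole k n (f \o S) (w \o S).
Proof.
rewrite /cup_hole big_mkcond big_ord_recl /= mulrCA; congr (_ * (_ * _)).
rewrite [RHS]big_mkcond; apply: eq_bigr => i _; rewrite /= /bump add1n eqSS.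
case: eqVneq => // ik.
have -> : unbump k.+1 i.+1 = (unbump k i).+1 by rewrite /unbump; lia.
by [].
Qed.

Lemma coboundary_cup_path (T : Type) n (f : nat -> T -> 'F_2) w :
  coboundary n (cup_path n f) w = 0.
Proof.
elim: n f w => [|n IHn] f w.
  rewrite /coboundary big_ord_recl big_ord1 /cup_path !big_ord0.
  exact: addrr_F2.
rewrite (_ : cup_path _ _ = fun v =>
  (f 0 (v 0) + f 0 (v 1)) * cup_path n (f \o S) (v \o S)).
  by rewrite coboundary_cup IHn mulr0.
by apply: funext => v; rewrite cup_path_recl.
Qed.

(** By the Leibniz rule the factors before [k] come out. For [k = 0] all faces but the first carry
    the factor [f 0 (w 0)]; since the remaining product is closed, their other factors add up to
    that of the first face. *)
Lemma coboundary_cup_hole (T : Type) k n (f : nat -> T -> 'F_2) w : (k <= n)%N ->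
  coboundary n (cup_hole k n.+1 f) w = cup_path n.+1 f w.
Proof.
elim: k n f w => [|k IHk] n f w kn.
  have := coboundary_cup_path n (f \o S) w.
  rewrite /coboundary !(big_ord_recl n.+1).
  move/eqP; rewrite addr_eq0 oppr_pchar2 ?pchar_Fp // => /eqP E.
  rewrite cup_hole0; under eq_bigr => i _ do
    rewrite cup_hole0 (_ : (w \o bump _) 0 = w 0) //.
  rewrite -big_distrr -E -mulrDl addrC cup_path_recl; exact: erefl.
case: n kn => // n kn; rewrite (_ : cup_hole _ _ _ = fun v =>
  (f 0 (v 0) + f 0 (v 1)) * cup_hole k n.+1 (f \o S) (v \o S)).
  by rewrite coboundary_cup IHk // [RHS]cup_path_recl.
by apply: funext => v; rewrite cup_holeS.
Qed.

Lemma eq_cup_hole (T : Type) k n (f : nat -> T -> 'F_2) (v w : nat -> T) :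
  (k <= n)%N -> (forall j, (j <= n)%N -> v j = w j) ->
  cup_hole k n.+1 f v = cup_hole k n.+1 f w.
Proof.
move=> kn vw; rewrite /cup_hole vw //; congr (_ * _).
apply: eq_bigr => i ik; have lt_in := ltn_ord i.
by rewrite !vw // /unbump; case: ltngtP ik => //; lia.
Qed.

(* The simplices of the Freudenthal triangulation of the cube with least vertex
   [z]: the [c]-th coordinate is increased at step [s c]. *)
Definition simplex_vertex n N (z : {ffun 'I_n -> 'I_N}) (s : 'S_n) (j : nat)
  (c : 'I_n) : nat := (z c + (s c < j))%N.

Section ModTwoSum.
Variables (n N : nat) (k : 'I_n.+1) (f : nat -> ('I_n.+1 -> nat) -> 'F_2).
Hypothesis f_face : forall (c : 'I_n.+1) (x y : 'I_n.+1 -> nat), c != k ->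
  x c = y c -> x c = 0%N \/ x c = N.+1 -> f c x = f c y.
Hypothesis fk_face : forall x : 'I_n.+1 -> nat, x k = 0%N \/ x k = N.+1 -> f k x = 0.

Let hole (z : {ffun 'I_n.+1 -> 'I_N.+1}) s j :=
  cup_hole k n.+1 f (simplex_vertex z s \o bump j).

(** For [c = k] the factor [f k] vanishes on the face; otherwise [f c] is constant there and its
    coboundary factor is zero. *)
Lemma cup_hole_face (c : 'I_n.+1) b (w : nat -> 'I_n.+1 -> nat) :
  b = 0%N \/ b = N.+1 -> (forall j, (j < n.+1)%N -> w j c = b) ->
  cup_hole k n.+1 f w = 0.
Proof.
move=> bE wE; have lt_k := ltn_ord k.
have [ck|ck] := eqVneq c k.
  by rewrite /cup_hole fk_face ?mul0r // -ck wE.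
rewrite /cup_hole (bigD1 c) //=.
have lt_c := ltn_ord c; have {}ckn : nat_of_ord c != k by [].
have ltu : (unbump k c < n.+1)%N /\ ((unbump k c).+1 < n.+1)%N.
  by rewrite /unbump; case: ltngtP ckn => //; lia.
have -> : f c (w (unbump k c)) = f c (w (unbump k c).+1).
  by case: ltu => ? ?; apply: f_face; rewrite ?wE.
by rewrite addrr_F2 mul0r mulr0.
Qed.

(* Swapping two consecutive steps pairs off the simplices around an inner face. *)
Lemma sum_inner_face (z : {ffun 'I_n.+1 -> 'I_N.+1}) (j : 'I_n) :
  \sum_s hole z s j.+1 = 0.
Proof.
pose t : 'S_n.+1 := tperm (inord j) (inord j.+1).
have tE (i : 'I_n.+1) m : m != j.+1 -> (t i < m)%N = (i < m)%N.
  have lt_j := ltn_ord j.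
  move=> mj; rewrite /t; case: tpermP => [->|->|//]; rewrite !inordK //; lia.
have tneq1 : odd_perm t.
  rewrite odd_tperm; apply/eqP => /(congr1 val); rewrite /= !inordK //;
    have := ltn_ord j; lia.
(* [t] is odd, so right multiplication by it matches the odd permutations with the even ones. *)
rewrite (bigID (fun s : 'S_n.+1 => odd_perm s)) /=.
rewrite (reindex_inj (mulIg t)) /=.
rewrite [X in X + _](eq_bigl (fun s : 'S_n.+1 => ~~ odd_perm s)); last first.
  by move=> s; rewrite odd_permM tneq1 addbT.
rewrite [X in X + _](eq_bigr (fun s => hole z s j.+1)) ?addrr_F2 //.
move=> s _; apply: eq_cup_hole; first by rewrite -ltnS.
move=> i _ /=; apply: funext => c; rewrite /simplex_vertex permM tE //.
by rewrite /bump; case: leqP; lia.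
Qed.

(* The face opposite the first vertex of a simplex is the face opposite the last
   vertex of the simplex shifted by its first step; wrapping around the grid is
   harmless since both terms vanish on the boundary. *)
Lemma sum_outer_faces :
  \sum_(s : 'S_n.+1) \sum_z hole z s 0 = \sum_(s : 'S_n.+1) \sum_z hole z s n.+1.
Proof.
(* [r] turns the first step into the last; [d] moves the base point by that step modulo [N.+1]. *)
pose r : 'S_n.+1 := perm (@ord_pred_inj n.+1).
rewrite [RHS](reindex_inj (mulIg r)) /=; apply: eq_bigr => s _.
pose d : {ffun 'I_n.+1 -> 'I_N.+1} := [ffun c => if s c == ord0 then inZp 1 else 0].
rewrite [RHS](reindex_inj (addrI d)) /=; apply: eq_bigr => z _.
have lt_k := ltn_ord k.
have rE c : s c != ord0 -> (r (s c)).+1 = s c.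
  rewrite permE /= -val_eqE /= -lt0n addnS /= => sc0.
  rewrite -{1}(prednK sc0) addSnnS modnDr modn_small ?prednK //.
  by have := ltn_ord (s c); lia.
have r0 c : s c = ord0 -> r (s c) = n :> nat.
  by move=> ->; rewrite permE /= modn_small.
have [c sc0] : exists c, s c = ord0 by exists (s^-1%g ord0); rewrite permKV.
have [zN|zN] := eqVneq (z c : nat) N.
  have -> : hole z s 0 = 0.
    apply: (@cup_hole_face c N.+1) => [|j jn]; first by right.
    by rewrite /= /simplex_vertex sc0 zN addn1.
  apply/esym; apply: (@cup_hole_face c 0) => [|j jn]; first by left.
  rewrite /= /simplex_vertex !ffunE sc0 eqxx permM r0 //=.
  by rewrite zN modnDml add1n modnn add0n /bump; case: leqP; lia.
apply: eq_cup_hole => // j jn; apply: funext => e /=.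
rewrite /simplex_vertex !ffunE permM.
case: (eqVneq (s e) ord0) => [se0|se0].
  have -> : e = c by apply: (@perm_inj _ s); rewrite se0 sc0.
  rewrite r0 // sc0 /= modnDml modn_small; last by have := ltn_ord (z c); lia.
  by rewrite /bump; case: leqP; lia.
rewrite add0r -(rE e) //; congr (_ + nat_of_bool _)%N.
by rewrite /bump; case: (leqP n.+1 j); lia.
Qed.

(** Stokes' formula mod 2: each summand is the coboundary of [cup_hole]; the inner faces cancel, and
    so do the two families of outer faces. *)
Lemma sum_cup_pathS_eq0 :
  \sum_(s : 'S_n.+1) \sum_(z : {ffun 'I_n.+1 -> 'I_N.+1})
    cup_path n.+1 f (simplex_vertex z s) = 0.
Proof.
under eq_bigr => s _ do under eq_bigr => z _ do
  rewrite -(@coboundary_cup_hole _ k) -1?ltnS // /coboundary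
    big_ord_recl big_ord_recr /=.
under eq_bigr => s _ do rewrite big_split big_split /=.
rewrite !big_split /= sum_outer_faces addrCA addrr_F2 addr0.
rewrite exchange_big big1 // => z _; rewrite exchange_big big1 // => j _.
by rewrite sum_inner_face.
Qed.

End ModTwoSum.

Lemma sum_cup_path_eq0 n N (k : 'I_n) (f : nat -> ('I_n -> nat) -> 'F_2) :
  (forall (c : 'I_n) (x y : 'I_n -> nat), c != k ->
     x c = y c -> x c = 0%N \/ x c = N.+1 -> f c x = f c y) ->
  (forall x : 'I_n -> nat, x k = 0%N \/ x k = N.+1 -> f k x = 0) ->
  \sum_(s : 'S_n) \sum_(z : {ffun 'I_n -> 'I_N.+1})
    cup_path n f (simplex_vertex z s) = 0.
Proof. by case: n k f => [[]//|n] k f; apply: sum_cup_pathS_eq0. Qed.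

Lemma cup_pathD (T : Type) n (k : 'I_n) (g h : nat -> T -> 'F_2) w :
  (forall i, i != k -> g i = h i) ->
  cup_path n g w + cup_path n h w =
  cup_path n (fun i x => if i == k then g i x + h i x else g i x) w.
Proof.
move=> gh; have D F : \prod_(i < n) F i = F k * \prod_(i < n | i != k) F i :> 'F_2.
  by rewrite (bigD1 k).
rewrite /cup_path !D eqxx.
rewrite (addrACA (g k _)) [RHS]mulrDl; congr (_ * _ + _ * _).
  by apply: eq_bigr => i /negPf ik; rewrite (ik : (i == k :> nat) = _).
by apply: eq_bigr => i /[dup] /gh -> /negPf ik; rewrite (ik : (i == k :> nat) = _).
Qed.

(* Replacing the [f c] one by one by the indicator of [0 < x c] changes each of
   them only off the faces [x c = 0] and [x c = N.+1]. *)
Lemma sum_cup_path_eq1 n N (f : nat -> ('I_n -> nat) -> 'F_2) :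
  (forall (c : 'I_n) x, x c = 0%N -> f c x = 0) ->
  (forall (c : 'I_n) x, x c = N.+1 -> f c x = 1) ->
  \sum_(s : 'S_n) \sum_(z : {ffun 'I_n -> 'I_N.+1})
    cup_path n f (simplex_vertex z s) = 1.
Proof.
move=> f0 f1.
pose std (i : nat) (x : 'I_n -> nat) : 'F_2 :=
  if insub i is Some c then (0 < x c)%N%:R else 0.
have stdE (c : 'I_n) x : std c x = (0 < x c)%N%:R by rewrite /std valK.
pose F m i := if (i < m)%N then std i else f i.
have F0 m (c : 'I_n) x : x c = 0%N -> F m c x = 0.
  by move=> xc; rewrite /F; case: ifP => _; rewrite ?stdE ?xc ?f0.
have F1 m (c : 'I_n) x : x c = N.+1 -> F m c x = 1.
  by move=> xc; rewrite /F; case: ifP => _; rewrite ?stdE ?xc ?f1.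
pose sum g := \sum_(s : 'S_n) \sum_(z : {ffun 'I_n -> 'I_N.+1})
    cup_path n g (simplex_vertex z s).
have sumF m : (m <= n)%N -> sum (F m) = sum f.
  elim: m => [|m IHm] lt_mn; first by [].
  rewrite -(IHm (ltnW lt_mn)); apply/eqP; rewrite -subr_eq0 oppr_pchar2 ?pchar_Fp //.
  have FS i : i != Ordinal lt_mn -> F m.+1 i = F m i.
    by move=> /negPf im; rewrite /F ltnS leq_eqVlt (im : (i == m :> nat) = _).
  rewrite /sum -big_split /=; under eq_bigr => s _ do rewrite -big_split /=.
  under eq_bigr => s _ do under eq_bigr => z _ do rewrite (cup_pathD _ FS).
  apply/eqP; apply: (sum_cup_path_eq0 (k := Ordinal lt_mn)).
    move=> c x y cm xy [xc|xc]; rewrite (negPf cm : (c == m :> nat) = _).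
      by rewrite !F0 -?xy.
    by rewrite !F1 -?xy.
  move=> x xm; rewrite eqxx.
  by case: xm => xm; [rewrite !(F0 _ _ _ xm)|rewrite !(F1 _ _ _ xm)]; rewrite addrr_F2.
rewrite -/(sum f) -(sumF n) // /sum.
have E s (z : {ffun 'I_n -> 'I_N.+1}) : cup_path n (F n) (simplex_vertex z s) =
   \prod_(i < n) ((0 < z i + (s i < i))%N%:R + (0 < z i + (s i < i.+1))%N%:R).
  by apply: eq_bigr => i _; rewrite /F ltn_ord !stdE.
(* For the indicators the [i]-th factor is nonzero only if [z i = 0] and [s i = i], so only the
   identity simplex at the origin contributes. *)
rewrite (bigD1 1%g) // (bigD1 [ffun=> ord0]) //= E big1 => [|i _]; last first.
  by rewrite ffunE perm1 ltnn ltnSn add0r.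
rewrite big1 => [|z zN0]; last first.
  have [i zi] : exists i, z i != ord0.
    apply/existsP; apply: contraR zN0; rewrite negb_exists => /forallP z0.
    by apply/eqP/ffunP => i; rewrite ffunE; apply/eqP; have := z0 i; rewrite negbK.
  rewrite E (bigD1 i) //=; have {}zi : (0 < z i)%N by rewrite lt0n.
  by rewrite !addn_gt0 zi /= addrr_F2 mul0r.
rewrite big1 ?addr0 // => s sN1; rewrite big1 // => z _.
have [i si] : exists i, s i != i.
  apply/existsP; apply: contraR sN1; rewrite negb_exists => /forallP s1.
  by apply/eqP/permP => i; rewrite perm1; apply/eqP; have := s1 i; rewrite negbK.
rewrite E (bigD1 i) //= ltnS [(s i <= i)%N]leq_eqVlt.
by rewrite (negPf si : (s i == i :> nat) = _) /= addrr_F2 mul0r.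
Qed.

(** The cup products sum to 1, so on some simplex no factor vanishes: each [b i] changes along the
    [i]-th edge. The vertices of a simplex lie in one grid cell. *)
Lemma cubical_sperner n N (b : 'I_n -> ('I_n -> nat) -> bool) :
  (forall c x, x c = 0%N -> b c x = false) ->
  (forall c x, x c = N.+1 -> b c x = true) ->
  exists2 z : 'I_n -> nat, forall c, (z c <= N)%N &
    forall i, exists x y, [/\ forall c, (z c <= x c <= (z c).+1)%N,
      forall c, (z c <= y c <= (z c).+1)%N, b i x = false & b i y = true].
Proof.
move=> b0 b1.
pose f (i : nat) (x : 'I_n -> nat) : 'F_2 :=
  if insub i is Some c then (b c x)%:R else 0.
have fE (c : 'I_n) x : f c x = (b c x)%:R by rewrite /f valK.
have : \sum_(s : 'S_n) \sum_(z : {ffun 'I_n -> 'I_N.+1})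
    cup_path n f (simplex_vertex z s) != 0.
  rewrite sum_cup_path_eq1 ?oner_neq0 // => c x xc.
    by rewrite fE b0.
  by rewrite fE b1.
rewrite pair_bigA /= => sum_neq0.
have [[s z] /= szN0] : exists p : 'S_n * {ffun 'I_n -> 'I_N.+1},
    cup_path n f (simplex_vertex p.2 p.1) != 0.
  apply/existsP; apply: contraR sum_neq0; rewrite negb_exists => /forallP p0.
  by rewrite big1 // => p _; apply/eqP; have := p0 p; rewrite negbK.
exists (fun c => z c) => [c|i]; first by rewrite -ltnS.
have wP j c : (z c <= simplex_vertex z s j c <= (z c).+1)%N.
  by rewrite /simplex_vertex; case: (_ < _)%N; lia.
move: szN0; rewrite prodf_seq_neq0 => /allP /(_ i).
rewrite mem_index_enum => /(_ isT) /=; rewrite !fE.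
case bi: (b i (simplex_vertex z s i)); case bi1: (b i (simplex_vertex z s i.+1)).
- by rewrite addrr_F2 eqxx.
- by exists (simplex_vertex z s i.+1), (simplex_vertex z s i); split.
- by exists (simplex_vertex z s i), (simplex_vertex z s i.+1); split.
- by rewrite addr0 eqxx.
Qed.

(** * Invariance of dimension *)

Lemma mx_norm_le (R : realType) n (x : 'rV[R]_n) (e : R) : 0 <= e ->
  (`|x| <= e) = [forall i, `|x ord0 i| <= e].
Proof.
move=> e0; rewrite [`|x|]mx_normrE; apply/bigmax_leP/forallP => [[_ H] i|H].
  exact: (H (ord0, i)).
by split=> // -[i j] _ /=; rewrite ord1.
Qed.

Lemma compact_unif_continuous (R : realType) (U V : normedModType R)
    (K : set U) (h : U -> V) :
  compact K -> continuous h ->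
  forall e, 0 < e -> exists2 d, 0 < d &
    forall x y, K x -> `|x - y| < d -> `|h x - h y| < e.
Proof.
move=> /compact_near_coveringP cK ch e e0.
(* Compactness in its near-covering form, with the filter of small positive [d]: a [d] that works
   locally around each point of [K] works on all of [K]. *)
have := cK R 0^'+ (fun d x => forall y, `|x - y| < d -> `|h x - h y| < e).
move=> /(_ _)[] => [x Kx|d /= d0 H].
  have /cvgrPdist_lt/(_ (e / 2)) := ch x; rewrite divr_gt0 // => /(_ isT).
  move=> /nbhs_ballP[d /= d0 H].
  exists (ball x (d / 2), [set t | 0 < t < d / 2]) => /=.
    split; first by apply: nbhsx_ballx; rewrite divr_gt0.
    by near=> t; apply/andP; split; near: t;
      [exact: nbhs_right_gt|apply: nbhs_right_lt; rewrite divr_gt0].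
  move=> [x' t] /= [xx' /andP[t0 td]] y x'y.
  have h1 : `|h x - h x'| < e / 2.
    by apply: H; apply: le_ball xx'; lra.
  have h2 : `|h x - h y| < e / 2.
    apply: H; rewrite -ball_normE /= -(subrKA x').
    rewrite -ball_normE /= in xx'.
    by apply: le_lt_trans (ler_normD _ _) _; lra.
  rewrite -(subrKA (h x)); rewrite distrC in h1.
  by apply: le_lt_trans (ler_normD _ _) _; lra.
exists (d / 2); first by rewrite divr_gt0.
move=> x y Kx xy; apply: (H (d / 2)) => //=; last by rewrite divr_gt0.
by rewrite sub0r normrN gtr0_norm ?divr_gt0 //; lra.
Unshelve. all: by end_near.
Qed.

Definition unit_cube (R : realType) n : set 'rV[R]_n :=
  [set x | forall i, 0 <= x ord0 i <= 1].

Lemma unit_cube_compact (R : realType) n : compact (@unit_cube R n).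
Proof.
have -> : @unit_cube R n = [set x : 'rV[R]_n | forall i, [set` `[0, 1]] (x ord0 i)].
  by apply/seteqP; split => x /= H i; have := H i; rewrite /= in_itv.
by apply: (@rV_compact R n (fun=> [set` `[0, 1]])) => i; exact: segment_compact.
Qed.

Section LeftInverse.
Variables (R : realType) (m n : nat).
Variables (f : 'rV[R]_n -> 'rV[R]_m) (g : 'rV[R]_m -> 'rV[R]_n).
Hypotheses (f_cont : continuous f) (g_cont : continuous g) (fK : cancel f g).

Lemma approx_coordinates : exists2 L : R, 0 < L &
  exists h : 'I_n -> 'rV[R]_n -> R,
    (forall i x, unit_cube x -> x ord0 i - 4^-1 <= h i x <= x ord0 i) /\
    (forall i x y, `|h i x - h i y| <= L * `|f x - f y|).
Proof.
have cfQ : compact (f @` @unit_cube R n).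
  apply: continuous_compact; last exact: unit_cube_compact.
  exact: continuous_subspaceT.
have [d d0 gd] := compact_unif_continuous cfQ g_cont (e := 4^-1) ltac:(lra).
have fd x y i : unit_cube x -> `|f x - f y| < d -> `|x ord0 i - y ord0 i| <= 4^-1.
  move=> Qx /(gd _ _ (imageP f Qx)); rewrite !fK => /ltW.
  by rewrite mx_norm_le ?invr_ge0 // => /forallP /(_ i); rewrite !mxE.
(* A point [y] whose image is at least [d] away from [f x] is penalised by at least 1; for nearer
   images the coordinates differ by at most [4^-1] by the choice of [d]. *)
pose E i x := [set y ord0 i + d^-1 * `|f x - f y| | y in @unit_cube R n].
have id0 : 0 < d^-1 by rewrite invr_gt0.
have E0 i x : lbound (E i x) 0.
  by move=> _ [y Qy <-]; rewrite addr_ge0 ?mulr_ge0 ?(ltW id0) //; case/andP: (Qy i).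
have EN0 i x : E i x !=set0.
  by exists (0 + d^-1 * `|f x - f 0|), 0; rewrite ?mxE // => j; rewrite mxE lexx ler01.
exists d^-1 => //; exists (fun i x => inf (E i x)); split.
  move=> i x Qx; apply/andP; split; last first.
    apply: ge_inf; first by exists 0.
    by exists x => //; rewrite subrr normr0 mulr0 addr0.
  apply: lb_le_inf => // _ [y Qy <-].
  have [/andP[x0 x1] /andP[y0 y1]] := (Qx i, Qy i).
  have [fxy|fxy] := ltP `|f x - f y| d.
    have := fd _ _ i Qx fxy; rewrite ler_distlC => /andP[? ?].
    have : 0 <= d^-1 * `|f x - f y| by rewrite mulr_ge0 // ltW.
    by lra.
  have : 1 <= d^-1 * `|f x - f y| by rewrite mulrC ler_pdivlMr // mul1r.
  lra.
have le_h i x y : inf (E i x) <= inf (E i y) + d^-1 * `|f x - f y|.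
  rewrite -lerBlDr; apply: lb_le_inf => // _ [z Qz <-].
  rewrite lerBlDr; apply: (@le_trans _ _ (z ord0 i + d^-1 * `|f x - f z|)).
    by apply: ge_inf; [exists 0|exists z].
  rewrite -addrA lerD2l -mulrDr ler_pM2l //.
  by rewrite -(subrKA (f y)) (addrC `|f y - _|) ler_normD.
move=> i x y; have := le_h i x y; have := le_h i y x.
by rewrite (distrC (f y)) ler_norml => ? ?; apply/andP; split; lra.
Qed.


(** Grid points are labelled by whether [h i] reaches [y i]; since [0 < y i <= 1/2 < 3/4], the
    bounds on [h] give the boundary labels. In the cell found by [cubical_sperner] each [h i] takes
    values on both sides of [y i], and the mesh is so fine that [h i] differs by at most [e] from
    its value at the corner. *)
Lemma approx_preimage (L : R) (h : 'I_n -> 'rV[R]_n -> R) (y : 'I_n -> R) (e : R) :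
  0 < L -> 0 < e ->
  (forall i x, unit_cube x -> x ord0 i - 4^-1 <= h i x <= x ord0 i) ->
  (forall i x y, `|h i x - h i y| <= L * `|f x - f y|) ->
  (forall i, 0 < y i <= 2^-1) ->
  exists2 x, unit_cube x & forall i, `|h i x - y i| <= e.
Proof.
move=> L0 e0 h_bnd h_lip y_bnd.
have eL0 : 0 < e / L by rewrite divr_gt0.
have [d d0 fd] := compact_unif_continuous (@unit_cube_compact R n) f_cont eL0.
pose N := Num.truncn d^-1.
have N0 : 0 < N.+1%:R :> R by rewrite ltr0n.
have Nd : N.+1%:R^-1 < d.
  have id0 : 0 < d^-1 by rewrite invr_gt0.
  by rewrite -[d]invrK ltf_pV2 ?posrE // real_truncnS_gt ?num_real.
pose pt (v : 'I_n -> nat) : 'rV[R]_n := \row_i ((v i)%:R / N.+1%:R).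
have ptQ v : (forall i, (v i <= N.+1)%N) -> unit_cube (pt v).
  move=> vN i; rewrite mxE divr_ge0 ?ler0n //=.
  by rewrite ler_pdivrMr // mul1r ler_nat.
(* Labels have to be given at all integer points, so these are clamped to the grid, which leaves the
   vertices of the cell found unchanged. *)
pose cl (v : 'I_n -> nat) i := minn (v i) N.+1.
pose lab i v := y i <= h i (pt (cl v)).
have clQ v : unit_cube (pt (cl v)) by apply: ptQ => i; rewrite geq_minr.
have [| |z zN zP] := @cubical_sperner n N lab.
- move=> c x xc; apply/negbTE; rewrite -ltNge.
  have /andP[_ hx] := h_bnd c _ (clQ x).
  have /andP[yc _] := y_bnd c; apply: le_lt_trans yc; apply: le_trans hx _.
  by rewrite mxE /cl xc min0n mul0r.
- move=> c x xc; rewrite /lab.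
  have /andP[hx _] := h_bnd c _ (clQ x); apply: le_trans hx.
  rewrite mxE /cl xc minnn divff ?gt_eqF //.
  by have /andP[_ yc] := y_bnd c; lra.
have zQ : unit_cube (pt z) by apply: ptQ => i; rewrite ltnW // ltnS.
exists (pt z) => // i.
have close v : (forall c, (z c <= v c <= (z c).+1)%N) ->
    `|h i (pt z) - h i (pt (cl v))| <= e.
  move=> zv; apply: le_trans (h_lip _ _ _) _.
  rewrite mulrC -ler_pdivlMr //; apply/ltW/fd => //.
  apply: le_lt_trans Nd; rewrite mx_norm_le ?invr_ge0 //; apply/forallP => j.
  rewrite !mxE (_ : cl v j = v j); last first.
    by rewrite /cl; have := zv j; have := zN j; lia.
  rewrite -mulrBl normrM (ger0_norm (_ : 0 <= N.+1%:R^-1)) ?invr_ge0 //.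
  rewrite ler_piMl ?invr_ge0 //.
  have [->|->] : v j = z j \/ v j = (z j).+1 by have := zv j; lia.
    by rewrite subrr normr0.
  by rewrite -natr1 opprD addNKr normrN normr1.
have [u [v [zu zv lu lv]]] := zP i.
have := close u zu; have := close v zv; move: lu lv; rewrite /lab => /negbT.
rewrite -ltNge !ler_norml => ? ? /andP[? ?] /andP[? ?]; apply/andP; split; lra.
Qed.

Theorem invariance_of_dimension : (n <= m)%N.
Proof.
rewrite leqNgt; apply/negP => lt_mn.
have [L L0 [h [h_bnd h_lip]]] := approx_coordinates.
have [M M0 fM] : exists2 M, 0 < M & forall x, unit_cube x -> `|f x| <= M.
  have /compact_bounded[M0 [_ HM]] : compact (f @` @unit_cube R n).
    apply: continuous_compact; last exact: unit_cube_compact.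
    exact: continuous_subspaceT.
  exists (`|M0| + 1); first by rewrite ltr_wpDl.
  by move=> x Qx; apply: HM; [have := ler_norm M0; lra|exists x].
(* Targets spaced by [1/(2p)] are hit up to [1/(16p)]. If two images are at most [1/D = 1/(4pL)]
   apart, the values of [h] are within [1/(4p)], hence the targets agree, as [1/4 + 2/16 < 1/2].
   Cells of side [1/D] number at most [C p] per axis, because [2 M D = 8 M L p < C p]. So
   [p^n <= C^m p^m], which [p > C^m] and [m < n] refute. *)
pose C := (Num.truncn (8 * M * L)).+1.
have CP : 8 * M * L < C%:R by rewrite real_truncnS_gt // num_real.
pose p := (C ^ m).+1.
have p0 : 0 < p%:R :> R by rewrite ltr0n.
pose y (t : {ffun 'I_n -> 'I_p}) i : R := (t i).+1%:R / (2 * p%:R).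
have e0 : 0 < (16 * p%:R)^-1 :> R by rewrite invr_gt0 mulr_gt0.
have y_bnd t i : 0 < y t i <= 2^-1.
  rewrite divr_gt0 ?ltr0n ?mulr_gt0 //=.
  rewrite ler_pdivrMr ?mulr_gt0 // mulKf ?pnatr_eq0 // ler_nat.
  exact: ltn_ord.
have /choice[x xP] (t : {ffun 'I_n -> 'I_p}) : exists x, unit_cube x /\
    forall i, `|h i x - y t i| <= (16 * p%:R)^-1.
  by have [x] := approx_preimage L0 e0 h_bnd h_lip (y_bnd t); exists x.
pose D := 4 * p%:R * L.
have D0 : 0 < D by rewrite /D !mulr_gt0.
have fx_bnd t j : 0 <= (f (x t) ord0 j + M) * D < (C * p)%:R.
  have := fM _ (xP t).1; rewrite mx_norm_le ?(ltW M0) // => /forallP /(_ j).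
  rewrite ler_norml => /andP[lo hi]; rewrite mulr_ge0 ?(ltW D0) //=; last lra.
  apply: (@le_lt_trans _ _ (2 * M * D)).
    by rewrite ler_pM2r //; lra.
  rewrite natrM (_ : 2 * M * D = 8 * M * L * p%:R); last by rewrite /D; ring.
  by rewrite ltr_pM2r.
have cell_bnd t j : (Num.truncn ((f (x t) ord0 j + M) * D) < C * p)%N.
  by have /andP[lo hi] := fx_bnd t j; rewrite truncn_lt_nat.
pose cell t : {ffun 'I_m -> 'I_(C * p)} := [ffun j => Ordinal (cell_bnd t j)].
have cell_inj : injective cell.
  move=> t u tu; apply/ffunP => i; apply/val_inj => /=.
  have fxy : `|f (x t) - f (x u)| <= D^-1.
    rewrite mx_norm_le ?invr_ge0 ?(ltW D0) //; apply/forallP => j.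
    move: tu => /ffunP /(_ j) /(congr1 val); rewrite !ffunE /= => tuj.
    have /andP[/truncn_itv/andP[tl tr] _] := fx_bnd t j.
    have /andP[/truncn_itv/andP[ul ur] _] := fx_bnd u j.
    rewrite !mxE -[D^-1]mul1r ler_pdivlMr //.
    rewrite -[X in _ * X](gtr0_norm D0) -normrM.
    move: tl tr ul ur; rewrite tuj -natr1 => ? ? ? ?.
    by rewrite ler_norml; apply/andP; split; lra.
  have hxy := h_lip i (x t) (x u).
  have : `|h i (x t) - h i (x u)| <= (4 * p%:R)^-1.
    apply: le_trans hxy _; rewrite -ler_pdivlMl //; apply: le_trans fxy _.
    by rewrite /D !invfM mulrC.
  have := (xP t).2 i; have := (xP u).2 i.
  rewrite !ler_norml !invfM => /andP[? ?] /andP[? ?] /andP[? ?].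
  have : `|y t i - y u i| < (2 * p%:R)^-1.
    have : 0 < p%:R^-1 :> R by rewrite invr_gt0.
    by rewrite ltr_norml !invfM => ?; apply/andP; split; lra.
  rewrite /y -mulrBl normrM [X in _ * X]ger0_norm ?invr_ge0 ?mulr_ge0 ?ler0n //.
  rewrite -[X in _ < X]mul1r ltr_pM2r ?invr_gt0 ?mulr_gt0 //.
  rewrite ltr_norml => /andP[lo hi].
  have : (t i).+1%:R < (u i).+2%:R :> R by rewrite -(natr1 (u i).+1); lra.
  have : (u i).+1%:R < (t i).+2%:R :> R by rewrite -(natr1 (t i).+1); lra.
  by rewrite !ltr_nat !ltnS => le_ut le_tu; apply: anti_leq; rewrite le_ut le_tu.
have := leq_card _ cell_inj; rewrite !card_ffun !card_ord expnMn leqNgt.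
case/negP; apply: leq_trans (leq_pexp2l (ltn0Sn _ : (0 < p)%N) lt_mn).
by rewrite expnS ltn_pmul2r ?expn_gt0.
Qed.

End LeftInverse.

(** * Inner product spaces *)

Section InnerSpaceTheory.
Variables (K : numFieldType) (theta : K -> K).
(** Holds for the identity of a real field and for complex conjugation, so Euclidean and unitary
    spaces are treated together. *)
Hypothesis thetaE : forall a, a * theta a = `|a| ^+ 2.
Implicit Types U V : innerSpace theta.

Lemma innerBl U (x y z : U) : inner U (x - y) z = inner U x z - inner U y z.
Proof. exact: zmod_morphisml_subproof. Qed.

Lemma innerBr U (x y z : U) : inner U z (x - y) = inner U z x - inner U z y.
Proof. exact: zmod_morphismr_subproof. Qed.

Lemma inner0l U (z : U) : inner U 0 z = 0.
Proof. by rewrite -(subrr (0 : U)) innerBl subrr. Qed.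

Lemma inner0r U (z : U) : inner U z 0 = 0.
Proof. by rewrite -(subrr (0 : U)) innerBr subrr. Qed.

Lemma innerDl U (x y z : U) : inner U (x + y) z = inner U x z + inner U y z.
Proof. by rewrite -{1}(opprK y) innerBl -[- y]sub0r innerBl inner0l sub0r opprK. Qed.

Lemma innerDr U (x y z : U) : inner U z (x + y) = inner U z x + inner U z y.
Proof. by rewrite -{1}(opprK y) innerBr -[- y]sub0r innerBr inner0r sub0r opprK. Qed.

Lemma innerZl U a (x y : U) : inner U (a *: x) y = a * inner U x y.
Proof. exact: linearl_subproof. Qed.

Lemma innerZr U a (x y : U) : inner U x (a *: y) = theta a * inner U x y.
Proof. exact: linearr_subproof. Qed.

Lemma inner_suml U (I : Type) (r : seq I) (F : I -> U) y :
  inner U (\sum_(i <- r) F i) y = \sum_(i <- r) inner U (F i) y.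
Proof.
apply: (big_morph (fun x => inner U x y)); last exact: inner0l.
by move=> u v; exact: innerDl.
Qed.

Lemma inner_sumr U (I : Type) (r : seq I) (F : I -> U) y :
  inner U y (\sum_(i <- r) F i) = \sum_(i <- r) inner U y (F i).
Proof.
apply: (big_morph (inner U y)); last exact: inner0r.
by move=> u v; exact: innerDr.
Qed.

Lemma inner_eq0 U (x : U) : (inner U x x == 0) = (x == 0).
Proof. by rewrite -inner_normE expf_eq0 normr_eq0. Qed.

Lemma inner_orthC U (x y : U) : inner U x y = 0 -> inner U y x = 0.
Proof.
move=> xy0; have th0 : inner U x y = theta (inner U y x).
  have := @hermitian_subproof _ _ _ _ (inner U) x y.
  by rewrite expr0 mul1r; exact.
by apply/eqP; rewrite -normr_eq0 -sqrf_eq0 -thetaE -th0 xy0 mulr0.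
Qed.

Lemma cauchy_schwarz U (x y : U) : `|inner U x y| <= `|x| * `|y|.
Proof.
have [->|y0] := eqVneq y 0; first by rewrite inner0r !normr0 mulr0.
have iy0 : inner U y y != 0 by rewrite inner_eq0.
pose a := inner U x y / inner U y y.
have [u uy xE] : exists2 u, inner U u y = 0 & x = u + a *: y.
  by exists (x - a *: y); rewrite ?subrK // innerBl innerZl divfK // subrr.
have yu := inner_orthC uy.
have : `|a| ^+ 2 * `|y| ^+ 2 <= `|x| ^+ 2.
  rewrite [in leRHS]inner_normE xE !(innerDl, innerDr, innerZl, innerZr) uy yu.
  by rewrite !mulr0 addr0 add0r [X in _ + X]mulrA thetaE -!inner_normE lerDr exprn_ge0.
rewrite -exprMn ler_pXn2r ?nnegrE ?mulr_ge0 // => ay.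
have -> : inner U x y = a * `|y| ^+ 2 by rewrite inner_normE divfK.
by rewrite normrM (ger0_norm (exprn_ge0 _ _)) // expr2 mulrA ler_wpM2r.
Qed.

(** The coordinates are inner products with the basis vectors multiplied by the inverse Gram matrix;
    Cauchy-Schwarz bounds them. *)
Lemma inner_coord U : exists c : 'I_(\dim {:U}) -> U -> K,
  (forall i, exists2 C, 0 <= C & forall x, `|c i x| <= C * `|x|) /\
  forall x, x = \sum_i c i x *: (vbasis {:U})`_i.
Proof.
set n := \dim _; set b := vbasis {:U}.
pose G := \matrix_(i < n, j < n) inner U b`_i b`_j.
have Gunit : G \in unitmx.
  rewrite -row_free_unit; apply/inj_row_free => v vG0.
  pose w := \sum_i v ord0 i *: b`_i.
  have wb (j : 'I_n) : inner U w b`_j = 0.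
    have := congr1 (fun M : 'rV_n => M ord0 j) vG0; rewrite !mxE => <-.
    by rewrite inner_suml; apply: eq_bigr => i _; rewrite innerZl mxE.
  have : w == 0.
    rewrite -inner_eq0 {2}/w inner_sumr big1 // => i _.
    by rewrite innerZr wb mulr0.
  have /freeP fb := basis_free (vbasisP {:U}).
  move=> /eqP /(fb (v ord0)) v0.
  by apply/rowP => i; rewrite v0 mxE.
exists (fun i x => \sum_(j < n) inner U x b`_j * invmx G j i); split.
  move=> i; exists (\sum_(j < n) `|b`_j| * `|invmx G j i|).
    by apply: sumr_ge0 => j _; rewrite mulr_ge0.
  move=> x; apply: le_trans (ler_norm_sum _ _ _) _.
  rewrite mulr_suml; apply: ler_sum => j _; rewrite normrM mulrAC ler_wpM2r //.
  by rewrite mulrC cauchy_schwarz.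
move=> x; rewrite {1}(coord_vbasis (memvf x)).
apply: eq_bigr => i _; congr (_ *: _).
pose cx := \row_i coord b i x.
have : (cx *m G) *m invmx G = cx by rewrite mulmxK.
move=> /(congr1 (fun M : 'rV_n => M ord0 i)); rewrite !mxE => <-.
apply: eq_bigr => j _; congr (_ * _); rewrite mxE.
rewrite [in RHS](coord_vbasis (memvf x)) inner_suml; apply: eq_bigr => k _.
by rewrite !mxE innerZl.
Qed.

Lemma inner_linear_continuous U (V : normedModType K) (f : {linear U -> V}) :
  continuous f.
Proof.
have [c [c_bnd cE]] := inner_coord U.
have /choice[C CP] i : exists C, 0 <= C /\ forall x, `|c i x| <= C * `|x|.
  by have [C] := c_bnd i; exists C.
apply: bounded_linear_continuous; apply/linear_boundedP.
near=> r => x; rewrite {1}(cE x) linear_sum.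
apply: le_trans (ler_norm_sum _ _ _) _.
apply: (@le_trans _ _ (\sum_i C i * `|f (vbasis {:U})`_i| * `|x|)).
  apply: ler_sum => i _; rewrite linearZ /= normrZ mulrAC ler_wpM2r //.
  exact: (CP i).2.
rewrite -mulr_suml ler_wpM2r //; near: r; apply: nbhs_pinfty_ge.
by rewrite ger0_real // sumr_ge0 // => i _; rewrite mulr_ge0 // (CP i).1.
Unshelve. all: by end_near.
Qed.

End InnerSpaceTheory.

(** * Real coordinates and the dimension of subspaces *)

Lemma continuous_rV (T : topologicalType) (R : realType) n (h : T -> 'rV[R]_n) :
  (forall i, continuous (fun x => h x ord0 i)) -> continuous h.
Proof.
move=> h_cont x; apply/cvgrPdist_le => e e0.
near=> y; rewrite mx_norm_le ?ltW //; apply/forallP; near: y.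
apply: filter_forall => i; near do rewrite !mxE.
by have /cvgrPdist_le := h_cont i x; exact.
Unshelve. all: by end_near.
Qed.

(** A homeomorphism between [R^k] and the scalar field, with [k = 1] for real and [k = 2] for
    complex scalars; it reduces both cases to [invariance_of_dimension]. *)
Record real_coordinates (R : realType) (K : numFieldType) (k : nat) := RealCoordinates {
  of_real : 'rV[R]_k -> K;
  to_real : K -> 'rV[R]_k;
  of_realK : cancel of_real to_real;
  to_realK : cancel to_real of_real;
  of_real_continuous : continuous of_real;
  to_real_continuous : continuous to_real
}.

Section SubspaceDimension.
Variables (R : realType) (K : numFieldType) (theta : K -> K) (k : nat).
Hypothesis thetaE : forall a, a * theta a = `|a| ^+ 2.
Variable rc : real_coordinates R K k.

(** The forms [coord (vbasis F) i] are linear on all of [U], so [c] is continuous on the whole space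
    and subspace topologies are avoided. *)
Lemma subspace_coordinates (U : innerSpace theta) (F : {vspace U}) :
  exists e : 'rV[R]_(\dim F * k) -> U, exists c : U -> 'rV[R]_(\dim F * k),
  [/\ continuous e, continuous c, forall x, e x \in F, cancel e c &
      {in F, cancel c e}].
Proof.
pose e (x : 'rV[R]_(\dim F * k)) : U :=
  \sum_i of_real rc (row i (vec_mx x)) *: (vbasis F)`_i.
pose c (v : U) : 'rV[R]_(\dim F * k) :=
  mxvec (\matrix_(i, j) to_real rc (coord (vbasis F) i v) ord0 j).
exists e, c; split.
- apply: continuous_big => [|i _ x]; first exact: add_continuous.
  have cof : continuous
      (of_real rc \o (fun y : 'rV[R]_(\dim F * k) => row i (vec_mx y))).
    move=> y; apply: continuous_comp; last exact: of_real_continuous.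
    apply: continuous_rV => j.
    rewrite (_ : (fun z => _) =
      (fun z : 'rV[R]_(\dim F * k) => z ord0 (mxvec_index i j))).
      exact: coord_continuous.
    by apply: funext => z; rewrite !mxE.
  exact: cvgZr_tmp (cof x).
- apply: continuous_rV => l; case/mxvec_indexP: l => i j.
  rewrite (_ : (fun y => _) =
    (fun v => to_real rc v ord0 j) \o (coord (vbasis F) i : U -> K^o)); last first.
    by apply: funext => y; rewrite /c mxvecE mxE.
  move=> v; apply: continuous_comp; first exact: (inner_linear_continuous thetaE).
  apply: (@continuous_comp _ _ _ (to_real rc) (fun M : 'rV_k => M ord0 j)).
    exact: to_real_continuous.
  exact: coord_continuous.
- move=> x; rewrite memv_suml // => i _.
  by rewrite memvZ // vbasis_mem // mem_nth // size_tuple.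
- move=> x; rewrite /c /e -[RHS]vec_mxK; congr mxvec; apply/matrixP => i j.
  by rewrite mxE coord_sum_free ?(basis_free (vbasisP F)) // of_realK mxE.
- move=> v Fv; rewrite {2}(coord_vbasis Fv); apply: eq_bigr => i _.
  rewrite /c mxvecK; congr (_ *: _); rewrite -[RHS](to_realK rc); congr of_real.
  by apply/rowP => j; rewrite !mxE.
Qed.

(** Read in real coordinates of [F] and [G], [phi] has a continuous left inverse; the common factor
    [k] of the real dimensions cancels. *)
Lemma homeo_dimv_le (U V : innerSpace theta) (phi : U -> V) (psi : V -> U)
    (F : {vspace U}) (G : {vspace V}) :
  continuous phi -> continuous psi -> cancel phi psi ->
  (forall x, x \in F -> phi x \in G) -> (0 < k)%N -> (\dim F <= \dim G)%N.
Proof.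
move=> cphi cpsi phiK FG k0.
have [eF [cF [eFc cFc eFF eFK _]]] := subspace_coordinates F.
have [eG [cG [eGc cGc _ _ cGK]]] := subspace_coordinates G.
rewrite -(leq_pmul2r k0).
apply: (@invariance_of_dimension R _ _ (cG \o phi \o eF) (cF \o psi \o eG)).
- move=> x; apply: continuous_comp; first exact: eFc.
  by apply: continuous_comp; [exact: cphi|exact: cGc].
- move=> x; apply: continuous_comp; first exact: eGc.
  by apply: continuous_comp; [exact: cpsi|exact: cFc].
- by move=> x /=; rewrite cGK ?phiK ?eFK // FG.
Qed.

End SubspaceDimension.

Lemma norm_Re_Im_le (R : rcfType) (z : R[i]) :
  `|z| <= (`|complex.Re z| + `|complex.Im z|)%:C%C.
Proof.
have norm_real (a : R) : `|a%:C%C| = `|a|%:C%C :> R[i].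
  by rewrite normc_def /= expr0n addr0 sqrtr_sqr.
rewrite {1}[z]complexE; apply: le_trans (ler_normD _ _) _.
have -> : `|'i%C * (complex.Im z)%:C%C| = `|complex.Im z|%:C%C :> R[i].
  by rewrite normrM norm_real normc_def /= expr0n expr1n add0r sqrtr1 mul1r.
by rewrite norm_real rmorphD.
Qed.

Lemma norm_Im_le (R : rcfType) (z : R[i]) : `|complex.Im z|%:C%C <= `|z|.
Proof.
by case: z => a b; simpc; rewrite -sqrtr_sqr ler_wsqrtr // lerDr sqr_ge0.
Qed.

Section RealStructures.
Variable R : realType.

Lemma real_coordinates_real : inhabited (real_coordinates R R 1).
Proof.
have K1 : cancel (fun x : 'rV[R]_1 => x ord0 ord0) (fun a : R => const_mx a).
  by move=> x; apply/rowP => i; rewrite mxE (ord1 i).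
have K2 : cancel (fun a : R => const_mx a) (fun x : 'rV[R]_1 => x ord0 ord0).
  by move=> a; rewrite mxE.
split; apply: (RealCoordinates K1 K2).
- exact: coord_continuous.
- apply: continuous_rV => i x; rewrite (_ : (fun _ => _) = id).
    exact: cvg_id.
  by apply: funext => a; rewrite mxE.
Qed.

Lemma real_coordinates_complex : inhabited (real_coordinates R R[i] 2).
Proof.
pose f (x : 'rV[R]_2) : R[i] := (x ord0 ord0 +i* x ord0 ord_max)%C.
pose g (z : R[i]) : 'rV[R]_2 :=
  \row_j (if j == ord0 then complex.Re z else complex.Im z).
have fK : cancel f g.
  move=> x; apply/rowP => i; rewrite mxE; case: eqVneq => [->//|i0] /=.
  by congr (x _ _); apply: val_inj; case: i i0 => -[|[|]].
have gK : cancel g f by case=> a b; rewrite /f !mxE.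
have ReB (a b : R[i]) : complex.Re (a - b) = complex.Re a - complex.Re b.
  by case: a b => ? ? [].
have ImB (a b : R[i]) : complex.Im (a - b) = complex.Im a - complex.Im b.
  by case: a b => ? ? [].
split; apply: (RealCoordinates fK gK).
- move=> x; apply/(@cvgrPdist_le _ _ _ (nbhs x)) => e e0.
  (* The radius [e] lies in [R[i]], where being positive includes being real. *)
  have [e1 e2] : e = (complex.Re e)%:C%C /\ 0 < complex.Re e.
    by move: e0; rewrite ltcE /= => /andP[/eqP]; case: e => a b /= ->.
  near=> y; have : `|x - y| <= complex.Re e / 2.
    near: y; apply: cvgr_dist_le; first exact: cvg_id.
    by rewrite divr_gt0.
  rewrite mx_norm_le; last by rewrite divr_ge0 // ltW.
  move=> /forallP xy; have := xy ord0; have := xy ord_max; rewrite !mxE => ? ?.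
  apply: le_trans (norm_Re_Im_le _) _; rewrite e1 lecR /=; lra.
- apply: continuous_rV => i z; apply/(@cvgrPdist_le _ _ _ (nbhs z)) => e e0; near=> w.
  have : `|z - w| <= e%:C%C.
    near: w; apply: cvgr_dist_le; first exact: cvg_id.
    by rewrite ltcR.
  rewrite /g !mxE => zw; rewrite -lecR; apply: le_trans zw.
  by case: ifP => _; rewrite -?ReB -?ImB; [exact: normc_ge_Re|exact: norm_Im_le].
Unshelve. all: by end_near.
Qed.
End RealStructures.

(** * Flags and linear isomorphisms *)

Definition inj_on (K : fieldType) (U V : vectType K) (P : {vspace U})
    (f : 'Hom(U, V)) : Prop := forall x, x \in P -> f x = 0 -> x = 0.

Lemma inj_on_dim (K : fieldType) (U V : vectType K) (P : {vspace U})
  (f : 'Hom(U, V)) : inj_on P f -> \dim (f @: P) = \dim P.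
Proof.
move=> f_inj; apply: limg_dim_eq; apply/eqP; rewrite -subv0.
by apply/subvP => x; rewrite memv_cap memv_ker memv0 => /andP[Px /eqP /f_inj ->].
Qed.

Lemma dim_inj_on (K : fieldType) (U V : vectType K) (P : {vspace U})
  (f : 'Hom(U, V)) : \dim (f @: P) = \dim P -> inj_on P f.
Proof.
move=> fP x Px fx0; have /eqP := limg_ker_dim f P.
rewrite fP -[X in _ == X]add0n eqn_add2r dimv_eq0 => /eqP PK.
by apply/eqP; rewrite -memv0 -PK memv_cap Px memv_ker fx0 eqxx.
Qed.

Lemma inj_onS (K : fieldType) (U V : vectType K) (P F : {vspace U})
  (f : 'Hom(U, V)) : (F <= P)%VS -> inj_on P f -> inj_on F f.
Proof. by move=> /subvP FP f_inj x Fx; apply/f_inj/FP. Qed.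

Lemma glue_hom (K : fieldType) (U V : vectType K) (P C : {vspace U})
    (f g : 'Hom(U, V)) : (P :&: C = 0)%VS ->
  exists h : 'Hom(U, V), {in P, h =1 f} /\ {in C, h =1 g}.
Proof.
move=> PC; have CP : (C :&: P = 0)%VS by rewrite capvC.
have pi0 (X Y : {vspace U}) x : (X :&: Y = 0)%VS -> x \in X -> daddv_pi Y X x = 0.
  move=> XY Xx; apply: (@addrI _ x); rewrite addr0 -{1}(daddv_pi_id XY Xx).
  exact: daddv_pi_add XY (subvP (addvSl X Y) x Xx).
exists ((f \o daddv_pi P C) + (g \o daddv_pi C P))%VF.
split => x Hx; rewrite add_lfunE !comp_lfunE.
  by rewrite (daddv_pi_id PC Hx) (pi0 _ _ _ PC Hx) linear0 addr0.
by rewrite (daddv_pi_id CP Hx) (pi0 _ _ _ CP Hx) linear0 add0r.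
Qed.

Lemma iso_of_dim (K : fieldType) (U V : vectType K) (C : {vspace U})
    (D : {vspace V}) : \dim C = \dim D -> exists f : 'Hom(U, V), (f @: C)%VS = D.
Proof.
move=> CD.
pose f x := \sum_(i < \dim C) coord (vbasis C) i x *: (vbasis D)`_i.
have f_lin : linear f.
  move=> a x y; rewrite /f scaler_sumr -big_split; apply: eq_bigr => i _ /=.
  by rewrite linearP scalerDl scalerA.
pose g := GRing.isLinear.Build _ _ _ _ f f_lin.
pose h := linfun (HB.pack_for {linear U -> V} f g).
have hE x : h x = f x by rewrite lfunE.
clearbody h; exists h; have CE := span_basis (vbasisP C).
transitivity (h @: <<vbasis C>>)%VS; first by rewrite CE.
rewrite limg_span -[RHS](span_basis (vbasisP D)).
congr <<_>>%VS; apply: (@eq_from_nth _ 0) => [|l]; rewrite size_map !size_tuple //.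
move=> lC; rewrite (nth_map 0) ?size_tuple // hE /f.
pose k := Ordinal lC; rewrite -[l]/(nat_of_ord k) (bigD1 k) //=.
have cE j : coord (vbasis C) j (vbasis C)`_k = (k == j)%:R.
  by rewrite coord_free ?(basis_free (vbasisP C)).
rewrite cE eqxx scale1r big1 ?addr0 // => j jk.
by rewrite cE eq_sym (negPf jk) scale0r.
Qed.

(** * Extending a partial isomorphism along a flag *)

Section Extension.
Variables (K : fieldType) (U V W : vectType K).
Variables (A : 'Hom(U, W)) (B : 'Hom(V, W)).

(* [t] prescribes [rho] on a complement of [P] in [F] *)
Definition extendable (P : {vspace U}) (rho : 'Hom(U, V)) (F : {vspace U})
    (G : {vspace V}) : Prop := exists t : 'Hom(U, V), forall c, c \in (F :\: P)%VS ->
  [/\ t c \in G, B (t c) = A c & forall p, p \in P -> rho p + t c = 0 -> c = 0].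

(** [rho] on [P] is glued with [t] on the complement. The last clause of [extendable] makes the
    result injective on [P + F], and equality of dimensions turns the inclusion of the image of [F]
    in [G] into an equality. *)
Lemma extend_step P rho F G :
  inj_on P rho -> (rho @: (P :&: F) <= G)%VS -> \dim F = \dim G ->
  {in P, forall x, B (rho x) = A x} -> extendable P rho F G ->
  exists rho' : 'Hom(U, V), [/\ {in P, rho' =1 rho}, inj_on (P + F) rho',
    (rho' @: F)%VS = G & {in (P + F)%VS, forall x, B (rho' x) = A x}].
Proof.
move=> rho_inj rhoF dimFG BA [t tP].
have PC : (P :&: (F :\: P) = 0)%VS by rewrite capvC capv_diff.
have [h [hP hC]] := glue_hom rho t PC.
have decomp x : x \in (P + F)%VS -> exists p c,
    [/\ p \in P, c \in (F :\: P)%VS & x = p + c].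
  by rewrite addvC -addv_diff addvC => /memv_addP[p Pp [c Cc ->]]; exists p, c.
have h_inj : inj_on (P + F) h.
  move=> x /decomp[p [c [Pp Cc ->]]]; rewrite linearD /= hP // hC // => pc.
  have [_ _ /(_ p Pp pc) c0] := tP c Cc.
  move: pc; rewrite c0 linear0 !addr0 /=; exact: rho_inj.
exists h; split => //.
  apply/eqP; rewrite eqEdim inj_on_dim ?dimFG ?leqnn ?andbT; last first.
    exact: inj_onS (addvSr _ _) h_inj.
  apply/subvP => _ /memv_imgP[x Fx ->].
  have [p [c [Pp Cc xE]]] := decomp x (subvP (addvSr P F) x Fx).
  have Fc : c \in F by rewrite (subvP (diffvSl F P)).
  have Fp : p \in F by rewrite -(rpredDr p Fc) -xE.
  rewrite xE linearD /= hP // hC // rpredD //; last by have [] := tP c Cc.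
  by apply: (subvP rhoF); rewrite memv_img // memv_cap Pp.
move=> x /decomp[p [c [Pp Cc ->]]].
by rewrite !linearD /= hP // hC // BA //; have [_ -> _] := tP c Cc.
Qed.

Definition le_pair (p q : {vspace U} * {vspace V}) :=
  (p.1 <= q.1)%VS && (p.2 <= q.2)%VS.

(** The flag is treated from its smallest member upwards. After [F] has joined the domain, the
    modular law carries the compatibility of [rho] with each larger member from [P] to [P + F]. With
    [A = B = 0] the commutation conditions are void. *)
Lemma flag_extension (s : seq ({vspace U} * {vspace V})) P rho :
  (forall (P' : {vspace U}) rho' F G, (F, G) \in s -> (P <= P')%VS ->
     inj_on P' rho' -> {in P', forall x, B (rho' x) = A x} ->
     (rho' @: (P' :&: F) = rho' @: P' :&: G)%VS -> \dim F = \dim G ->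
     extendable P' rho' F G) ->
  pairwise le_pair s -> inj_on P rho ->
  (forall F G, (F, G) \in s -> 
    \dim F = \dim G /\ (rho @: (P :&: F) = rho @: P :&: G)%VS) ->
  {in P, forall x, B (rho x) = A x} ->
  exists rho' : 'Hom(U, V), [/\ {in P, rho' =1 rho},
    forall F G, (F, G) \in s -> (rho' @: F)%VS = G &
    forall F G x, (F, G) \in s -> x \in F -> B (rho' x) = A x].
Proof.
elim: s P rho => [|[F G] s IHs] P rho ext; first by move=> _ _ _ BA; exists rho.
rewrite pairwise_cons => /andP[/allP le_s sorted_s] rho_inj compat BA.
have [dimFG rhoF] := compat F G (mem_head _ _).
have rhoFG : (rho @: (P :&: F) <= G)%VS by rewrite rhoF capvSr.
have extF := ext P rho F G (mem_head _ _) (subvv _) rho_inj BA rhoF dimFG.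
have [h [hP h_inj hF hBA]] := extend_step rho_inj rhoFG dimFG BA extF.
have h_img (X : {vspace U}) : (X <= P)%VS -> (h @: X = rho @: X)%VS.
  by move=> /subvP XP; apply: eq_in_limg => x /XP; exact: hP.
have [P' rho' F' G' s' leP'|F' G' s'|h' [h'P h's h'BA]] :=
  IHs (P + F)%VS h _ sorted_s h_inj _ hBA.
- apply: ext; first by rewrite inE s' orbT.
  exact: subv_trans (addvSl _ _) leP'.
- have [|dim' rho'] := compat F' G'; first by rewrite inE s' orbT.
  split=> //; have /andP[/= leF leG] := le_s _ s'.
  rewrite addvC -vspace_modl // limgD hF h_img ?capvSl // rho'.
  by rewrite limgD hF h_img // vspace_modl // addvC.
exists h'; split => [x Px|F' G'|F' G' x]; rewrite ?inE.
- by rewrite h'P ?hP // (subvP (addvSl _ _)).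
- case/predU1P => [[-> ->]|]; last exact: h's.
  rewrite -hF; apply: eq_in_limg => x Fx.
  by rewrite h'P // (subvP (addvSr _ _)).
case/predU1P => [[-> _] Fx|]; last exact: h'BA.
by rewrite h'P ?hBA // (subvP (addvSr _ _)).
Qed.

End Extension.

(** The complements of [P] in [F] and of [rho @: P] in [G] have equal dimensions, so any isomorphism
    between them serves as [t]. *)
Lemma extendable_free (K : fieldType) (U V W : vectType K) (P : {vspace U})
    (rho : 'Hom(U, V)) (F : {vspace U}) (G : {vspace V}) :
  inj_on P rho -> (rho @: (P :&: F) = rho @: P :&: G)%VS -> \dim F = \dim G ->
  extendable (0 : 'Hom(U, W)) (0 : 'Hom(V, W)) P rho F G.
Proof.
move=> rho_inj rhoF dimFG; set Q := (rho @: P)%VS.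
have CD : \dim (F :\: P)%VS = \dim (G :\: Q)%VS.
  apply: (@addIn (\dim (P :&: F)%VS)).
  rewrite -{2}(inj_on_dim (inj_onS (capvSl P F) rho_inj)) rhoF.
  have dimD (T : vectType K) (X Y : {vspace T}) :
      (\dim (X :\: Y) + \dim (Y :&: X) = \dim X)%N.
    rewrite capvC -{3}(addv_diff_cap X Y) dimv_disjoint_sum //.
    by apply/eqP; rewrite -subv0 -(capv_diff X Y) capvS // capvSr.
  by rewrite !dimD.
have [t tC] := iso_of_dim CD.
have t_inj : inj_on (F :\: P) t by apply: dim_inj_on; rewrite tC.
exists t => c Cc; have tcD : t c \in (G :\: Q)%VS by rewrite -tC memv_img.
split; first by rewrite (subvP (diffvSl _ _) _ tcD).
  by rewrite !lfunE.
move=> p Pp /eqP; rewrite addrC addr_eq0 => /eqP tcE.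
apply: t_inj Cc _; apply/eqP; rewrite -memv0 -(capv_diff G Q) memv_cap tcD /=.
by rewrite tcE rpredN memv_img.
Qed.

(** [t c] is a solution of [B y = A c] in [G]. If [rho p + t c = 0], applying [B] puts [p + c] in
    [lker A], hence in [P]; so [c] lies in [P] and in its complement. *)
Lemma extendable_lift (K : fieldType) (U V W : vectType K) (A : 'Hom(U, W))
    (B : 'Hom(V, W)) (P : {vspace U}) (rho : 'Hom(U, V)) (F : {vspace U})
    (G : {vspace V}) :
  (lker A <= P)%VS -> {in P, forall x, B (rho x) = A x} ->
  (A @: F = B @: G)%VS -> extendable A B P rho F G.
Proof.
move=> kerA BA AB; pose B' := (B \o projv G)%VF.
exists (projv G \o (B'^-1 \o A))%VF => c Cc.
have Fc : c \in F by rewrite (subvP (diffvSl F P)).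
have Bt : B ((projv G \o (B'^-1 \o A))%VF c) = A c.
  rewrite !comp_lfunE -[B (projv G _)]comp_lfunE limg_lfunVK // limg_comp limg_proj -AB.
  exact: memv_img.
split=> //; first by rewrite comp_lfunE memv_proj.
move=> p Pp /(congr1 B); rewrite linear0 linearD /= BA // Bt -linearD /= => /eqP.
rewrite -memv_ker => /(subvP kerA) Ppc.
have Pc : c \in P by rewrite -(rpredDl c Pp).
by apply/eqP; rewrite -memv0 -(capv_diff F P) memv_cap Cc.
Qed.

(** * Matching flags and their transport through an arrow *)

Definition matching (K : fieldType) (U V : vectType K) (phi : U -> V)
  (F : {vspace U}) (G : {vspace V}) : Prop := forall x, (x \in F) = (phi x \in G).

(** The pair of full spaces is a member so that a linear map respecting the flag is onto. *)
Definition matching_flag (K : fieldType) (U V : vectType K) (phi : U -> V)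
    (s : seq ({vspace U} * {vspace V})) : Prop :=
  [/\ pairwise (@le_pair K U V) s, (fullv, fullv) \in s &
      forall F G, (F, G) \in s -> matching phi F G].

Definition respects (K : fieldType) (U V : vectType K)
    (s : seq ({vspace U} * {vspace V})) (f : 'Hom(U, V)) : Prop :=
  forall F G, (F, G) \in s -> (f @: F)%VS = G.

(* The only property of homeomorphisms that the linear algebra needs. *)
Record dim_bijection (K : fieldType) (U V : vectType K) (phi : U -> V) : Prop :=
  DimBijection {
    dim_bijection_bij : bijective phi;
    dim_bijection0 : phi 0 = 0;
    dim_bijection_dim : forall F G, matching phi F G -> \dim F = \dim G
  }.

Section Arrow.
Variables (K : fieldType) (U V U' V' : vectType K).
Variables (phi : U -> V) (phi' : U' -> V').
Variables (a : 'Hom(U, U')) (b : 'Hom(V, V')).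
Hypotheses (phiB : dim_bijection phi) (phi'B : dim_bijection phi').
Hypothesis ab : forall x, phi' (a x) = b (phi x).

Lemma matching_preim F' G' :
  matching phi' F' G' -> matching phi (a @^-1: F') (b @^-1: G').
Proof. by move=> FG x; rewrite -!memv_preim -ab FG. Qed.

Lemma matching_img F G : matching phi F G -> matching phi' (a @: F) (b @: G).
Proof.
move=> FG x; have [psi phiK psiK] := dim_bijection_bij phiB.
apply/memv_imgP/memv_imgP => [[u Fu ->]|[v Gv xv]].
  by exists (phi u); rewrite -?FG.
exists (psi v); first by rewrite FG psiK.
by apply: (bij_inj (dim_bijection_bij phi'B)); rewrite ab psiK.
Qed.

Lemma matching_lker : matching phi (lker a) (lker b).
Proof.
move=> x; rewrite !memv_ker -ab -[X in _ = (_ == X)](dim_bijection0 phi'B).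
by rewrite (inj_eq (bij_inj (dim_bijection_bij phi'B))).
Qed.

Lemma matchingI F G F1 G1 : matching phi F G -> matching phi F1 G1 ->
  matching phi (F :&: F1) (G :&: G1).
Proof. by move=> FG FG1 x; rewrite !memv_cap FG FG1. Qed.

Lemma respects_inj s (f : 'Hom(U, V)) :
  matching_flag phi s -> respects s f -> lker f == 0%VS.
Proof.
case=> _ full _ fs; apply/eqP/vspaceP => x; rewrite memv_ker memv0.
apply/eqP/eqP => [fx0|->]; last exact: linear0.
apply: (@dim_inj_on _ _ _ fullv f) fx0; rewrite ?memvf //.
rewrite (fs _ _ full); apply/esym/(dim_bijection_dim phiB) => y.
by rewrite !memvf.
Qed.

Lemma push_flag s : matching_flag phi s -> exists s', matching_flag phi' s' /\
  forall f', lker f' == 0%VS -> respects s' f' ->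
    exists2 f, respects s f & forall x, f' (a x) = b (f x).
Proof.
case=> sorted_s full_s match_s.
pose img (p : {vspace U} * {vspace V}) := ((a @: p.1)%VS, (b @: p.2)%VS).
exists (rcons (map img s) (fullv, fullv)); split.
  split.
  - rewrite pairwise_rcons pairwise_map; apply/andP; split.
      by apply/allP => p _; rewrite /le_pair /= !subvf.
    apply: sub_pairwise sorted_s => p q /andP[p1 p2].
    by rewrite /le_pair /= !limgS.
  - by rewrite mem_rcons mem_head.
  - move=> F G; rewrite mem_rcons inE => /predU1P[[-> ->] x|]; first by rewrite !memvf.
    by case/mapP=> -[F1 G1] /match_s m [-> ->]; exact: matching_img.
move=> f' f'_inj f's.
have dim_s F G : (F, G) \in s -> \dim F = \dim G.
  by move=> /match_s /(dim_bijection_dim phiB).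
have f'a F G : (F, G) \in s -> ((f' \o a)%VF @: F = b @: G)%VS.
  move=> sFG; rewrite limg_comp; apply: f's; rewrite mem_rcons inE; apply/orP; right.
  by apply/mapP; exists (F, G).
have ker_f'a : lker (f' \o a)%VF = lker a.
  apply/vspaceP => x; rewrite !memv_ker comp_lfunE.
  by rewrite -[in RHS](inj_eq (lker0P f'_inj)) linear0.
(* First an isomorphism [kappa] of the kernels is built that respects the traces of the flag on
   them. *)
pose kap (p : {vspace U} * {vspace V}) := ((p.1 :&: lker a)%VS, (p.2 :&: lker b)%VS).
have [|||||kappa [_ kappa_s _]] := @flag_extension _ U V U 0 0 (map kap s) 0%VS 0.
- by move=> P' rho' F G _ _ inj _; exact: extendable_free.
- rewrite pairwise_map; apply: sub_pairwise sorted_s => p q /andP[p1 p2].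
  by rewrite /le_pair /= !capvS.
- by move=> x; rewrite memv0 => /eqP.
- move=> F G /mapP[[F1 G1] /match_s m [-> ->]]; split.
    exact: (dim_bijection_dim phiB) (matchingI m matching_lker).
  by rewrite cap0v limg0 cap0v.
- by move=> x _; rewrite !lfunE.
have kappa_cap F G : (F, G) \in s -> (kappa @: (lker a :&: F) = lker b :&: G)%VS.
  move=> sFG; rewrite capvC [RHS]capvC; apply: kappa_s.
  by apply/mapP; exists (F, G).
have kappa_ker : (kappa @: lker a = lker b)%VS.
  by have := kappa_cap _ _ full_s; rewrite !capvf.
(* Then [kappa] is extended to [f] by lifting [f' \o a] through [b], one flag member at a time. *)
have [|||||f [_ fs fb]] := @flag_extension _ U V V' (f' \o a)%VF b s (lker a) kappa.
- move=> P' rho' F G sFG kerP _ BA _ _; apply: extendable_lift => //.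
    by rewrite ker_f'a.
  exact: f'a.
- exact: sorted_s.
- apply: dim_inj_on; rewrite kappa_ker.
  exact/esym/(dim_bijection_dim phiB)/matching_lker.
- by move=> F G sFG; split; [exact: dim_s|rewrite (kappa_cap _ _ sFG) kappa_ker].
- move=> x kx; rewrite comp_lfunE (eqP (_ : a x == 0)) -?memv_ker // linear0.
  by apply/eqP; rewrite -memv_ker -kappa_ker memv_img.
exists f; first exact: fs.
by move=> x; rewrite (fb _ _ _ full_s) ?memvf // comp_lfunE.
Qed.

Lemma pull_flag s' : matching_flag phi' s' -> exists s, matching_flag phi s /\
  forall f, lker f == 0%VS -> respects s f ->
    exists2 f', respects s' f' & forall x, f' (a x) = b (f x).
Proof.
case=> sorted_s full_s match_s.
pose pre (p : {vspace U'} * {vspace V'}) := ((a @^-1: p.1)%VS, (b @^-1: p.2)%VS).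
exists ((lker a, lker b) :: map pre s'); split.
  split.
  - rewrite pairwise_cons pairwise_map; apply/andP; split.
      by apply/allP => _ /mapP[p _ ->]; rewrite /le_pair -!lpreim0 /= !lpreimS ?sub0v.
    apply: sub_pairwise sorted_s => p q /andP[p1 p2].
    by rewrite /le_pair /= !lpreimS.
  - rewrite inE; apply/orP; right; apply/mapP; exists (fullv, fullv) => //.
    by congr pair; apply/vspaceP => x; rewrite -memv_preim !memvf.
  - move=> F G; rewrite inE => /predU1P[[-> ->]|]; first exact: matching_lker.
    by case/mapP=> -[F1 G1] /match_s m [-> ->]; exact: matching_preim.
move=> f f_inj fs.
have f_ker : (f @: lker a = lker b)%VS by apply: fs; rewrite mem_head.
(* The map induced by [f] between the images of [a] and [b]; the choice of preimages is immaterial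
   because [f] maps [lker a] onto [lker b]. *)
pose rho := (b \o f \o a^-1)%VF.
have rhoa x : rho (a x) = b (f x).
  rewrite !comp_lfunE; apply/eqP; rewrite -subr_eq0 -!linearB /= -memv_ker -f_ker.
  apply: memv_img; rewrite memv_ker linearB /= limg_lfunVK ?subrr //.
  by rewrite memv_img ?memvf.
have rho_img (X : {vspace U}) : (rho @: (a @: X) = b @: (f @: X))%VS.
  rewrite -!limg_comp; apply: eq_in_limg => x _.
  by rewrite comp_lfunE rhoa comp_lfunE.
have f_full : limg f = fullv.
  apply/eqP; rewrite eqEdim subvf /= (limg_dim_eq _) ?(eqP f_inj) ?capv0 //.
  by rewrite (dim_bijection_dim phiB (F := fullv) (G := fullv)) // => x; rewrite !memvf.
have rho_full : (rho @: limg a = limg b)%VS by rewrite rho_img f_full.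
have [|||||f' [f'rho f's _]] := @flag_extension _ U' V' U' 0 0 s' (limg a) rho.
- by move=> P' rho' F G _ _ inj _; exact: extendable_free.
- exact: sorted_s.
- move=> _ /memv_imgP[x _ ->]; rewrite rhoa => /eqP; rewrite -memv_ker -f_ker.
  case/memv_imgP=> y ay /(lker0P f_inj) ->.
  by apply/eqP; rewrite -memv_ker.
- move=> F G sFG; split; first exact: (dim_bijection_dim phi'B) (match_s _ _ sFG).
  have -> : (limg a :&: F = a @: (a @^-1: F))%VS.
    by rewrite capvC -lpreim_cap_limg lpreimK ?capvSr.
  rewrite rho_img rho_full (fs (a @^-1: F)%VS (b @^-1: G)%VS); last first.
    by rewrite inE; apply/orP; right; apply/mapP; exists (F, G).
  by rewrite capvC -lpreim_cap_limg lpreimK ?capvSr.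
- by move=> x _; rewrite !lfunE.
exists f'; first exact: f's.
by move=> x; rewrite f'rho ?rhoa // memv_img ?memvf.
Qed.

End Arrow.

Lemma respects_exists (K : fieldType) (U V : vectType K) (phi : U -> V) s :
  dim_bijection phi -> matching_flag phi s -> exists f : 'Hom(U, V), respects s f.
Proof.
move=> phiB [sorted_s _ match_s].
have [|||||f [_ fs _]] := @flag_extension _ U V U 0 0 s 0%VS 0; last by exists f.
- by move=> P' rho' F G _ _ inj _; exact: extendable_free.
- exact: sorted_s.
- by move=> x; rewrite memv0 => /eqP.
- move=> F G /match_s m; split; last by rewrite cap0v limg0 cap0v.
  exact: (dim_bijection_dim phiB) m.
- by move=> x _; rewrite !lfunE.
Qed.

(** * Chains *)

Section ChainLinearization.
Variables (K : numFieldType) (theta : K -> K) (t : nat) (o : 'I_t.-1 -> bool).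
Variables A B : chain theta o.

Definition commutes_at (F : forall j, 'Hom(chain_space A j, chain_space B j))
    (i : 'I_t.-1) : Prop := forall x,
  F (arrow_target o i) (chain_map A i x) = chain_map B i (F (arrow_source o i) x).

Variable phi : forall j : 'I_t, chain_space A j -> chain_space B j.
Arguments phi : clear implicits.
Hypothesis phiB : forall j, dim_bijection (phi j).
Hypothesis phiC : forall (i : 'I_t.-1) x,
  phi (arrow_target o i) (chain_map A i x) =
  chain_map B i (phi (arrow_source o i) x).

Lemma flag_across (i : 'I_t.-1) s : matching_flag (phi (left_end i)) s ->
  exists s', matching_flag (phi (right_end i)) s' /\
    forall f', lker f' == 0%VS -> respects s' f' -> exists2 f, respects s f &
      forall F : forall j, 'Hom(chain_space A j, chain_space B j),
        F (left_end i) = f -> F (right_end i) = f' -> commutes_at F i.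
Proof.
move=> flag_s.
have ends : (arrow_source o i = left_end i /\ arrow_target o i = right_end i) \/
    (arrow_source o i = right_end i /\ arrow_target o i = left_end i).
  by rewrite /arrow_source /arrow_target; case: (o i); [left|right].
(* The types of the chain maps depend on [o i]; source and target become variables so that either
   orientation can be substituted. *)
rewrite /commutes_at; move: (chain_map A i) (chain_map B i) (phiC (i := i)).
move: (arrow_source o i) (arrow_target o i) ends => src tgt ends a b ab.
have ab' x : phi tgt (linfun a x) = linfun b (phi src x) by rewrite !lfunE ab.
case: ends => -[src_E tgt_E]; subst src tgt.
  have [s' [flag_s' s'P]] := push_flag (phiB _) (phiB _) ab' flag_s.
  exists s'; split=> // f' f'_inj /(s'P _ f'_inj)[f fs fab].
  by exists f => // F -> -> x; have := fab x; rewrite !lfunE.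
have [s' [flag_s' s'P]] := pull_flag (phiB _) (phiB _) ab' flag_s.
exists s'; split=> // f' f'_inj /(s'P _ f'_inj)[f fs fab].
by exists f => // F -> -> x; have := fab x; rewrite !lfunE.
Qed.

(** The invariant of the sweep. [F] is a total family, but only its members up to [k] are
    constrained. *)
Definition extends_left (k : 'I_t) : Prop := exists s,
  matching_flag (phi k) s /\ forall f, respects s f ->
    exists F : forall j, 'Hom(chain_space A j, chain_space B j),
      [/\ F k = f, forall j : 'I_t, (j <= k)%N -> lker (F j) == 0%VS &
          forall i : 'I_t.-1, (i < k)%N -> commutes_at F i].

Lemma extends_left_all (k : 'I_t) : extends_left k.
Proof.
case: k => k; elim: k => [|k IHk] lt_kt.
  exists [:: (fullv, fullv)]; split.
    split; rewrite ?mem_head // => F G; rewrite inE => /eqP[-> ->] x.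
    by rewrite !memvf.
  move=> f fs.
  (* The value 0 at the other indices is a mere default. *)
  pose F := eqtype.dfwith (fun j => 0 : 'Hom(chain_space A j, chain_space B j)) f.
  exists F; split => //; first exact: eqtype.dfwith_in.
  move=> j; rewrite leqn0 => /eqP j0; have -> : j = Ordinal lt_kt by apply: val_inj.
  rewrite /F eqtype.dfwith_in; apply: respects_inj fs; first exact: phiB.
  by split; rewrite ?mem_head // => G H; rewrite inE => /eqP[-> ->] x; rewrite !memvf.
have lt_kt1 : (k < t.-1)%N by rewrite ltn_predRL.
pose i : 'I_t.-1 := Ordinal lt_kt1.
have -> : Ordinal lt_kt = right_end i by apply: val_inj.
have [s [flag_s sP]] : extends_left (left_end i).
  have -> : left_end i = Ordinal (ltnW lt_kt) by apply: val_inj.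
  exact: IHk.
have [s' [flag_s' s'P]] := flag_across flag_s.
exists s'; split=> // f' f's.
have f'_inj := respects_inj (phiB _) flag_s' f's.
have [f fs fC] := s'P f' f'_inj f's.
have [F [Ff F_inj FC]] := sP f fs.
pose F' := eqtype.dfwith F f'.
have F'R : F' (right_end i) = f' by exact: eqtype.dfwith_in.
have F'F j : j != right_end i -> F' j = F j.
  by rewrite eq_sym; exact: eqtype.dfwith_out.
exists F'; split => //.
  move=> j; rewrite leq_eqVlt => /orP[/eqP/val_inj->|jk].
    by rewrite F'R.
  rewrite F'F; last by apply: contraTneq jk => ->; rewrite ltnn.
  exact: F_inj.
move=> e; rewrite ltnS leq_eqVlt => /orP[/eqP/val_inj->|ek].
  by apply: fC => //; rewrite F'F // -val_eqE /= ltn_eqF.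
have {}ek : (e < k)%N by [].
have [src_E tgt_E] : F' (arrow_source o e) = F (arrow_source o e) /\
    F' (arrow_target o e) = F (arrow_target o e).
  by split; apply: F'F; rewrite /arrow_source /arrow_target; case: (o e);
    rewrite -val_eqE /=; lia.
by move=> x; rewrite src_E tgt_E FC.
Qed.

(** At the last space [respects_exists] provides a map respecting the flag, which the sweep extends
    back over the whole chain. *)
Lemma chain_linearization : (0 < t)%N -> linearly_isomorphic A B.
Proof.
move=> t0; have lt_tt : (t.-1 < t)%N by rewrite ltn_predL.
have [s [flag_s sP]] := extends_left_all (Ordinal lt_tt).
have [f fs] := respects_exists (phiB _) flag_s.
have [F [_ F_inj FC]] := sP f fs.
exists (fun j => F j); split; last by move=> j; exact: linearP.
split=> [j|i x]; last by apply: FC => /=.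
have Fj_inj : lker (F j) == 0%VS by apply: F_inj; rewrite /= -ltnS prednK.
have Fj_full : limg (F j) = fullv.
  apply/eqP; rewrite eqEdim subvf /= (limg_dim_eq _) ?(eqP Fj_inj) ?capv0 //.
  rewrite (dim_bijection_dim (phiB j) (F := fullv) (G := fullv)) // => x.
  by rewrite !memvf.
exists (F j)^-1%VF => x; first exact: lker0_lfunK.
by rewrite limg_lfunVK // Fj_full memvf.
Qed.

End ChainLinearization.

(** * From topological to linear isomorphisms and back *)

Section TopologicalChains.
Variables (R : realType) (K : numFieldType) (theta : K -> K) (k : nat).
Hypothesis thetaE : forall a, a * theta a = `|a| ^+ 2.
Hypothesis k_gt0 : (0 < k)%N.
Variable rc : real_coordinates R K k.

Lemma homeo_dim_bijection (U V : innerSpace theta) (phi : U -> V) :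
  homeomorphism phi -> dim_bijection (fun x => phi x - phi 0).
Proof.
case=> psi [phiK psiK phi_c psi_c].
have psi0_c : continuous (fun y => psi (y + phi 0)).
  move=> y; apply: (@continuous_comp _ _ _ (fun y => y + phi 0) psi).
    by apply: cvgD; [exact: cvg_id|exact: cvg_cst].
  exact: psi_c.
have phi0_c : continuous (fun x => phi x - phi 0).
  by move=> x; apply: cvgB; [exact: phi_c|exact: cvg_cst].
have phi0K : cancel (fun x => phi x - phi 0) (fun y => psi (y + phi 0)).
  by move=> x; rewrite subrK phiK.
have psi0K : cancel (fun y => psi (y + phi 0)) (fun x => phi x - phi 0).
  by move=> y; rewrite psiK addrK.
split; first by exists (fun y => psi (y + phi 0)).
  by rewrite subrr.
move=> F G FG; apply/eqP; rewrite eqn_leq.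
rewrite (homeo_dimv_le thetaE rc phi0_c psi0_c phi0K) // => [|x]; last by rewrite FG.
rewrite (homeo_dimv_le thetaE rc psi0_c phi0_c psi0K) // => y Gy.
by rewrite FG psi0K.
Qed.

Lemma linear_homeo (U V : innerSpace theta) (phi : U -> V) :
  linear phi -> bijective phi -> homeomorphism phi.
Proof.
move=> phi_lin phi_bij; pose mix := GRing.isLinear.Build _ _ _ _ phi phi_lin.
pose f := linfun (HB.pack_for {linear U -> V} phi mix).
have fE : f = phi :> (U -> V) by apply: funext => x; rewrite lfunE.
have f_inj : lker f == 0%VS by apply/lker0P; rewrite fE; exact: bij_inj.
have fVK : cancel f^-1%VF f.
  have [psi _ psiK] := phi_bij.
  move=> y; rewrite limg_lfunVK //; apply/memv_imgP; exists (psi y); rewrite ?memvf //.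
  by rewrite fE psiK.
exists f^-1%VF; rewrite -fE; split => //; first exact: lker0_lfunK.
  exact: (inner_linear_continuous thetaE).
exact: (inner_linear_continuous thetaE).
Qed.

Lemma chain_iso_equiv (t : nat) (o : 'I_t.-1 -> bool) (A B : chain theta o) :
  (0 < t)%N -> topologically_isomorphic A B <-> linearly_isomorphic A B.
Proof.
move=> t0; split => [[phi [[_ phiC] phi_homeo]]|[phi [[phi_bij phiC] phi_lin]]].
  apply: (@chain_linearization _ _ _ _ _ _ (fun j x => phi j x - phi j 0)) => //.
    by move=> j; exact: homeo_dim_bijection.
  (* Translating to the origins keeps the squares commutative, since the chain maps send [phi] at 0
     to [phi] at 0. *)
  move=> i x; rewrite linearB /= -!phiC; congr (_ - phi _ _).
  by rewrite linear0.
by exists phi; split => // j; apply: linear_homeo.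
Qed.

End TopologicalChains.

Theorem theorem1 (R : realType) (t : nat) (ht : (0 < t)%N)
    (o : 'I_t.-1 -> bool) :
  (forall A B : unitaryChain R o,
     topologically_isomorphic A B <-> linearly_isomorphic A B) /\
  (forall A B : euclideanChain R o,
     topologically_isomorphic A B <-> linearly_isomorphic A B).
Proof.
split => A B.
  have [rc] := real_coordinates_complex R.
  by apply: (chain_iso_equiv _ _ rc) => // a; rewrite -normCK.
have [rc] := real_coordinates_real R.
apply: (chain_iso_equiv _ _ rc) => // a.
by rewrite real_normK ?num_real.
Qed.
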